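(* Let $p$ be a multi-threshold censorship model on $\mathbb B_d$ and $\lambda>0$. For a measurable path $a:[0,T]\to\mathbb B_d$ let $\mathbb W(t)=\lambda I_d+\int_0^tp(a(s))a(s)a(s)^\top ds$. Then there exists $d_{\mathrm{eff}}>0$ (independent of $T$) such that, as $T\to\infty$, $$\sup_{a(\cdot)}\int_0^T\frac1{p(a(t))}\frac{d}{dt}\log\det\mathbb W(t)\,dt=d_{\mathrm{eff}}\log T+o(\log T),$$ and $d_{\mathrm{eff}}$ falls into one of two cases: (Case 1, single region) $d_{\mathrm{eff}}=d/p_j$ for some $j\in\{0,\dots,k\}$; or (Case 2, bi-region) there exist regions $i<j$ with $$\max\big(1,s^\star(i,j)\big)<\frac{p_i}{p_j}<r^\star(i,j)$$ and $$d_{\mathrm{eff}}=\frac1{p_j}\Big[(d-1)\frac{1-l(i,j)}{\frac{p_i}{p_j}-l(i,j)}+\frac{u(i,j)-1}{u(i,j)-\frac{p_i}{p_j}}\Big]<\frac d{p_j},$$ where $l(i,j)=\frac{\sin^2\phi_i}{\sin^2\phi_j}$, $u(i,j)=\frac{\cos^2\phi_i}{\cos^2\phi_j}$, $s^\star(i,j)=\frac{d\,l(i,j)u(i,j)}{u(i,j)+(d-1)l(i,j)}$ and $r^\star(i,j)=\frac{(d-1)u(i,j)+l(i,j)}{d}$.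
   Context: $\mathbb B_d$ denotes the closed Euclidean unit ball of $\mathbb R^d$, $d\ge2$. Multi-threshold censorship model: integer $k\ge0$, angles $-\pi/2=\phi_0<\phi_1<\dots<\phi_{k+1}=\pi/2$, a unit vector $u\in\mathbb R^d$, and probabilities $1\ge p_0\ge p_1\ge\dots\ge p_k>0$ (non-increasing in $j$, i.e. censorship increases in direction $u$); $p(a)=p_j$ whenever $\sin\phi_j\le\langle a,u\rangle<\sin\phi_{j+1}$ (and $p(a)=p_k$ if $\langle a,u\rangle=1$). The set $\{a:\sin\phi_j\le\langle a,u\rangle<\sin\phi_{j+1}\}$ is called region $j$. The integrand $\frac1{p(a(t))}\frac{d}{dt}\log\det\mathbb W(t)$ equals $\mathrm{Tr}(\mathbb W(t)^{-1}a(t)a(t)^\top)$ for a.e. $t$. *)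

(* Defs.v *)
From HB Require Import structures.
From mathcomp Require Import all_boot all_order all_algebra.
From mathcomp Require Import all_classical all_reals all_analysis.
Set Implicit Arguments. Unset Strict Implicit. Unset Printing Implicit Defensive.
Import Order.TTheory GRing.Theory Num.Theory.
Import numFieldNormedType.Exports.
Local Open Scope classical_set_scope.
Local Open Scope ring_scope.

Section Model.
Variable R : realType.

Definition cc0 (T : R) : set R := `[0, T]%classic.

Definition dotv (d : nat) (x y : 'rV[R]_d) : R := \sum_(i < d) x 0 i * y 0 i.

Definition in_ball (d : nat) (x : 'rV[R]_d) : Prop := dotv x x <= 1.

Definition is_censorship_model (d k : nat) (phi : nat -> R) (u : 'rV[R]_d)
    (pr : nat -> R) : Prop :=
  [/\ phi 0%N = - (pi / 2), phi k.+1 = pi / 2,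
      (forall j, (j <= k)%N -> phi j < phi j.+1) &
      dotv u u = 1] /\
  [/\
      pr 0%N <= 1,
      (forall j, (j < k)%N -> pr j.+1 <= pr j) &
      0 < pr k].

(* p(a) = p_j when sin phi_j <= <a,u> < sin phi_{j+1}, and p_k when <a,u> = 1.
   (The regions are disjoint, so at most one summand is nonzero.) *)
Definition censor_prob (d k : nat) (phi : nat -> R) (u : 'rV[R]_d)
    (pr : nat -> R) (a : 'rV[R]_d) : R :=
  \sum_(j < k.+1)
     (if (sin (phi j) <= dotv a u) && (dotv a u < sin (phi j.+1)) then pr j else 0)
  + (if dotv a u == 1 then pr k else 0).

Definition Wmat (d : nat) (p : 'rV[R]_d -> R) (lam : R) (a : R -> 'rV[R]_d)
    (t : R) : 'M[R]_d :=
  \matrix_(i < d, j < d)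
    (lam * (i == j)%:R
     + Rintegral (@lebesgue_measure R) `[0, t]%classic
         (fun s => p (a s) * (a s) 0 i * (a s) 0 j)).

Definition admissible_path (d : nat) (T : R) (a : R -> 'rV[R]_d) : Prop :=
  (forall i : 'I_d, measurable_fun `[0, T]%classic (fun t => (a t) 0 i)) /\
  (forall t, `[0, T]%classic t -> in_ball (a t)).

(* The integrand (1/p(a(t))) d/dt log det W(t), which a.e. equals
   Tr(W(t)^{-1} a(t) a(t)^T); with row vectors a a^T is (a^T *m a). *)
Definition integrand (d : nat) (p : 'rV[R]_d -> R) (lam : R)
    (a : R -> 'rV[R]_d) (t : R) : R :=
  \tr (invmx (Wmat p lam a t) *m ((a t)^T *m a t)).

Definition value (d : nat) (p : 'rV[R]_d -> R) (lam T : R) : \bar R :=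
  ereal_sup [set (\int[@lebesgue_measure R]_(t in cc0 T) (integrand p lam a t)%:E)%E
            | a in [set a | admissible_path T a]].

Definition lfun (phi : nat -> R) (i j : nat) : R :=
  (sin (phi i)) ^+ 2 / (sin (phi j)) ^+ 2.
Definition ufun (phi : nat -> R) (i j : nat) : R :=
  (cos (phi i)) ^+ 2 / (cos (phi j)) ^+ 2.
Definition sstar (d : nat) (phi : nat -> R) (i j : nat) : R :=
  d%:R * lfun phi i j * ufun phi i j / (ufun phi i j + (d%:R - 1) * lfun phi i j).
Definition rstar (d : nat) (phi : nat -> R) (i j : nat) : R :=
  ((d%:R - 1) * ufun phi i j + lfun phi i j) / d%:R.

End Model.

(* Main.v *)
(* Only the last region matters.  Every action of the ball has censorship
   probability at least p_k, and p(a(t)) Tr(W(t)^-1 a(t) a(t)^T) integrates to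
   ln det W(T) - d ln lam, which is at most d ln T + O(1); hence the value is at
   most (d / p_k) ln T + O(1).  Conversely, region k is a cap around u with
   nonempty interior, so it contains a spanning set of actions; playing each of
   them for a fixed fraction of [0, T] makes W(T) >= c T I while p = p_k all
   along, which gives the matching lower bound.  Thus d_eff = d / p_k, always in
   the single-region case.  *)
Require Import Defs.
From HB Require Import structures.
From mathcomp Require Import all_boot all_order all_algebra.
From mathcomp Require Import ring lra.
From mathcomp Require Import all_classical all_reals all_analysis.
From mathcomp Require Import measurable_realfun.
Set Implicit Arguments. Unset Strict Implicit. Unset Printing Implicit Defensive.
Import Order.TTheory GRing.Theory Num.Theory.
Import numFieldNormedType.Exports.
Local Open Scope classical_set_scope.
Local Open Scope ring_scope.

(** * Positive definite matrices *)

(** The path is only measurable, so the identity for [ln (\det (W T))] is obtained without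
    differentiating. On a short interval, concavity of [ln \o \det] based at either end traps the
    increment between two traces. Since [W >= lam I], the inverses at the two ends differ by a
    factor of at most [1 + K h / lam], where [h] is the length. On a uniform partition this factor
    is the same for all pieces, so it is not compounded, and it tends to 1. Concavity is reduced by
    a congruence to [ln (\det C) <= \tr C - n], which needs pivots but no eigenvalues.
    Multiplicative constants inside the logarithms only change the bounded term, so crude ones
    suffice: [k + 2] as upper bound for the probability, and a small tilt of [u] for the spanning
    actions. *)

Definition qform (R : realType) (n : nat) (A : 'M[R]_n) (x : 'rV[R]_n) : R :=
  (x *m A *m x^T) 0 0.

Definition posdef (R : realType) (n : nat) (A : 'M[R]_n) : Prop :=
  A^T = A /\ forall x : 'rV[R]_n, x != 0 -> 0 < qform A x.

Section PosDef.
Variable R : realType.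

Lemma dotvE (n : nat) (x y : 'rV[R]_n) : dotv x y = (x *m y^T) 0 0.
Proof. by rewrite mxE; apply: eq_bigr => i _; rewrite mxE. Qed.

(** Cyclicity of the trace; this connects [integrand], defined by a trace, with the order on
    quadratic forms. *)
Lemma qform_tr (n : nat) (A : 'M[R]_n) (x : 'rV[R]_n) :
  qform A x = \tr (A *m (x^T *m x)).
Proof. by rewrite mulmxA mxtrace_mulC mulmxA /mxtrace big_ord1. Qed.

Lemma qformE (n : nat) (A : 'M[R]_n) (x : 'rV[R]_n) :
  qform A x = \sum_(i < n) \sum_(j < n) A i j * (x 0 i * x 0 j).
Proof.
rewrite qform_tr; apply: eq_bigr => i _; rewrite mxE; apply: eq_bigr => j _.
by rewrite mxE big_ord1 mxE [x 0 j * _]mulrC.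
Qed.

Lemma qform_congr (n : nat) (A M : 'M[R]_n) (x : 'rV[R]_n) :
  qform (M *m A *m M^T) x = qform A (x *m M).
Proof. by rewrite /qform trmx_mul !mulmxA. Qed.

Lemma qform0 (n : nat) (A : 'M[R]_n) : qform A 0 = 0.
Proof. by rewrite /qform !mul0mx mxE. Qed.

Lemma qformZ (n : nat) (c : R) (A : 'M[R]_n) (x : 'rV[R]_n) :
  qform (c *: A) x = c * qform A x.
Proof. by rewrite /qform -scalemxAr -scalemxAl mxE. Qed.

Lemma qform_scalar (n : nat) (c : R) (x : 'rV[R]_n) :
  qform c%:M x = c * dotv x x.
Proof. by rewrite dotvE /qform mul_mx_scalar -scalemxAl mxE. Qed.

Lemma qformB (n : nat) (A : 'M[R]_n) (x y : 'rV[R]_n) : A^T = A ->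
  qform A (x - y) = qform A x - 2 * dotv (x *m A) y + qform A y.
Proof.
move=> As; rewrite dotvE /qform linearB /= !(mulmxBl, mulmxBr) !mxE.
have -> : (\sum_j (y *m A) 0 j * x^T j 0) = \sum_j (x *m A) 0 j * y^T j 0.
  transitivity ((y *m A *m x^T)^T 0 0); first by rewrite !mxE.
  by rewrite !trmx_mul As trmxK mulmxA mxE.
by rewrite !mulr2n; ring.
Qed.

Lemma dotv_ge0 (n : nat) (x : 'rV[R]_n) : 0 <= dotv x x.
Proof. by apply: sumr_ge0 => i _; rewrite -expr2 sqr_ge0. Qed.

Lemma dotv_gt0 (n : nat) (x : 'rV[R]_n) : x != 0 -> 0 < dotv x x.
Proof.
move=> x0; rewrite lt_neqAle dotv_ge0 andbT eq_sym.
apply: contra x0 => /eqP /psumr_eq0P x0; apply/eqP/rowP => i; rewrite mxE.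
by apply/eqP; rewrite -sqrf_eq0 expr2 x0// => j _; rewrite -expr2 sqr_ge0.
Qed.

Lemma posdef_qform_ge0 (n : nat) (A : 'M[R]_n) (x : 'rV[R]_n) :
  posdef A -> 0 <= qform A x.
Proof. by case=> _ Ap; have [->|/Ap/ltW//] := eqVneq x 0; rewrite qform0. Qed.

Lemma posdef_unitmx (n : nat) (A : 'M[R]_n) : posdef A -> A \in unitmx.
Proof.
move=> [_ Ap]; rewrite -row_free_unit; apply: inj_row_free => v vA.
apply/eqP/negPn/negP => /Ap; by rewrite /qform vA mul0mx mxE ltxx.
Qed.

Lemma posdef_congr (n : nat) (A M : 'M[R]_n) :
  M \in unitmx -> posdef A -> posdef (M *m A *m M^T).
Proof.
move=> Mu [As Ap]; split; first by rewrite !trmx_mul trmxK As mulmxA.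
move=> x x0; rewrite qform_congr Ap//; apply: contra x0 => /eqP xM.
by rewrite -(mulmxK Mu x) xM mul0mx.
Qed.

Lemma posdef_inv (n : nat) (A : 'M[R]_n) : posdef A -> posdef (invmx A).
Proof.
move=> Ap; have Au := posdef_unitmx Ap.
have -> : invmx A = invmx A *m A *m (invmx A)^T.
  by rewrite mulVmx// mul1mx trmx_inv Ap.1.
by apply: posdef_congr => //; rewrite unitmx_inv.
Qed.

Lemma posdef_scale (n : nat) (c : R) (A : 'M[R]_n) :
  0 < c -> posdef A -> posdef (c *: A).
Proof.
move=> c0 [As Ap]; split=> [|x x0]; first by rewrite linearZ /= As.
by rewrite qformZ mulr_gt0// Ap.
Qed.

Lemma posdef_scalar (n : nat) (c : R) : 0 < c -> posdef (c%:M : 'M[R]_n).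
Proof.
move=> c0; split=> [|x x0]; first by rewrite tr_scalar_mx.
by rewrite qform_scalar mulr_gt0// dotv_gt0.
Qed.

Lemma posdef_block (n : nat) (a : R) (b : 'rV[R]_n) (C : 'M[R]_n) :
  posdef (block_mx a%:M b b^T C : 'M[R]_(1 + n)) -> 0 < a /\ posdef C.
Proof.
move=> [As Ap]; split.
  have := Ap (row_mx 1%:M 0).
  rewrite /qform mul_row_block tr_row_mx mul_row_col !mul0mx !mul1mx.
  rewrite trmx0 mulmx0 !addr0 trmx1 mulmx1 mxE mulr1n; apply.
  apply/eqP => /(congr1 lsubmx)/matrixP/(_ 0 0).
  by rewrite row_mxKl linear0 !mxE; apply/eqP; rewrite oner_neq0.
split; first by move: As; rewrite tr_block_mx => /eq_block_mx[].
move=> x x0; have := Ap (row_mx 0 x).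
rewrite /qform mul_row_block tr_row_mx mul_row_col !mul0mx.
rewrite trmx0 mulmx0 !add0r; apply.
apply: contra x0 => /eqP/(congr1 rsubmx).
by rewrite row_mxKr linear0 => ->.
Qed.

(* The bound on [ln (\det A)] is proved along the same Schur complement
   induction: each pivot [a] contributes [ln a <= a - 1], and the trace can
   only decrease when passing to the Schur complement. *)
Lemma cholesky (n : nat) (A : 'M[R]_n) : posdef A ->
  exists2 L : 'M[R]_n, A = L *m L^T & ln (\det A) <= \tr A - n%:R.
Proof.
elim: n A => [|n IH] => [A Ap|].
  exists 1%:M; first by apply/matrixP => -[].
  by rewrite det_mx00 ln1 subr0 /mxtrace big_ord0.
rewrite -[n.+1]/(1 + n)%N => A Ap; have [As _] := Ap.
have [a [b [C Aa]]] : exists (a : R) (b : 'rV[R]_n) (C : 'M[R]_n),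
    A = block_mx a%:M b b^T C :> 'M[R]_(1 + n).
  exists (A 0 0), (ursubmx (A : 'M[R]_(1 + n))), (drsubmx (A : 'M[R]_(1 + n))).
  rewrite -[LHS](submxK (A : 'M[R]_(1 + n))) trmx_ursub As.
  congr block_mx; rewrite [LHS]mx11_scalar !mxE; congr (A _ _)%:M;
    exact/val_inj.
pose S := C - a^-1 *: (b^T *m b).
pose D : 'M[R]_(1 + n) := block_mx a%:M 0 0 S.
have [a0 _] : 0 < a /\ posdef C by apply: (@posdef_block _ _ b); rewrite -Aa.
(* Block elimination: [U] is unit lower triangular and [A = U D U^T], so [D] has the determinant of
   [A] and inherits positivity by congruence. *)
pose U : 'M[R]_(1 + n) := block_mx 1%:M 0 (a^-1 *: b^T) 1%:M.
have detU : \det U = 1 by rewrite det_lblock !det1 mulr1.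
have Uu : U \in unitmx by rewrite unitmxE detU unitr1.
have AU : A = U *m D *m U^T.
  rewrite Aa /U /D mulmx_block tr_block_mx mulmx_block.
  rewrite !(mul1mx, mulmx1, mul0mx, mulmx0, trmx1, trmx0, addr0, add0r).
  rewrite linearZ /= trmxK -!scalemxAl !mul_mx_scalar !mul_scalar_mx !scalerA.
  rewrite divff ?gt_eqF// scale1r; congr block_mx.
    by rewrite mulVf ?gt_eqF// scale1r.
  by rewrite -scalemxAl -scalemxAr !scalerA mulVf ?gt_eqF// mul1r /S addrC subrK.
have Dp : posdef D.
  have -> : D = invmx U *m A *m (invmx U)^T.
    rewrite AU trmx_inv !mulmxA mulVmx// mul1mx -mulmxA mulmxV ?mulmx1//.
    by rewrite unitmx_tr.
  by apply: posdef_congr => //; rewrite unitmx_inv.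
have Dp' : posdef (block_mx a%:M 0 0^T S : 'M[R]_(1 + n)) by rewrite trmx0.
have [_ Sp] := posdef_block Dp'.
have [L SL lnS] := IH S Sp.
(* Needed to split [ln (a * \det S)]; the factor [L] given by induction makes [\det S] a nonzero
   square. *)
have detS : 0 < \det S.
  have /posdef_unitmx := Sp; rewrite unitmxE unitfE SL det_mulmx det_tr.
  by rewrite -expr2 sqrf_eq0 => L0; rewrite exprn_even_gt0.
exists (U *m block_mx (Num.sqrt a)%:M 0 0 L).
  rewrite trmx_mul AU !mulmxA; congr (_ *m _); rewrite -mulmxA; congr (_ *m _).
  rewrite tr_block_mx mulmx_block /D.
  rewrite !(mul0mx, mulmx0, trmx0, addr0, add0r) SL tr_scalar_mx.
  by rewrite -scalar_mxM -expr2 sqr_sqrtr// ltW.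
rewrite AU !det_mulmx det_tr detU mul1r mulr1 /D det_ublock det_scalar1.
rewrite lnM ?posrE// -AU Aa mxtrace_block.
have -> : \tr (a%:M : 'M[R]_1) = a by rewrite mxtrace_scalar.
have trS : \tr S <= \tr C.
  rewrite /S linearB /= linearZ /= lerBlDr lerDl pmulr_rge0 ?invr_gt0//.
  by rewrite mxtrace_mulC /mxtrace big_ord1 -dotvE dotv_ge0.
have lna : ln a <= a - 1.
  have : a = 1 + (a - 1) by rewrite addrC subrK.
  move=> {1}->; apply: le_ln1Dx; lra.
rewrite [(1 + n)%N]addnC natrD; lra.
Qed.

Lemma posdef_det_gt0 (n : nat) (A : 'M[R]_n) : posdef A -> 0 < \det A.
Proof.
move=> Ap; have /posdef_unitmx := Ap; rewrite unitmxE unitfE.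
have [L -> _] := cholesky Ap; rewrite det_mulmx det_tr -expr2 sqrf_eq0 => L0.
by rewrite exprn_even_gt0.
Qed.

(* Concavity of [ln \o \det] on the positive definite cone. *)
Lemma ln_det_sub_le (n : nat) (A B : 'M[R]_n) : posdef A -> posdef B ->
  ln (\det A) - ln (\det B) <= \tr (invmx B *m (A - B)).
Proof.
move=> Ap Bp; have [L BL _] := cholesky Bp.
have detB := posdef_det_gt0 Bp; have detA := posdef_det_gt0 Ap.
have L0 : \det L != 0.
  have := detB; rewrite BL det_mulmx det_tr; apply: contraTneq => ->.
  by rewrite mul0r ltxx.
have Lu : L \in unitmx by rewrite unitmxE unitfE.
(* Whitening by [B = L L^T]: this matrix has determinant [\det A / \det B] and trace [\tr (B^-1 A)],
   so the bound [ln (\det C) <= \tr C - n] for it is the claim. *)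
have Cp : posdef (invmx L *m A *m (invmx L)^T).
  by apply: posdef_congr => //; rewrite unitmx_inv.
have [_ _] := cholesky Cp.
have -> : \det (invmx L *m A *m (invmx L)^T) = \det A / \det B.
  rewrite !det_mulmx det_tr det_inv BL det_mulmx det_tr; field; exact: L0.
have -> : \tr (invmx L *m A *m (invmx L)^T) = \tr (invmx B *m A).
  have -> : invmx B = (invmx L)^T *m invmx L.
    apply: (can_inj (mulKmx (posdef_unitmx Bp))); rewrite mulmxV ?posdef_unitmx//.
    rewrite BL trmx_inv mulmxA -(mulmxA L) mulmxV ?unitmx_tr// mulmx1 mulmxV//.
  by rewrite mxtrace_mulC mulmxA.
rewrite ln_div ?posrE// mulmxBr mulVmx ?posdef_unitmx// linearB /= mxtrace1.
by [].
Qed.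

(** Expand [0 <= qform A (x A^-1 - x B^-1)]: the cross term is [-2 x B^-1 x^T], and the last term is
    at most [qform B (x B^-1) = x B^-1 x^T]. *)
Lemma qform_inv_anti (n : nat) (A B : 'M[R]_n) (x : 'rV[R]_n) :
  posdef A -> posdef B -> (forall y, qform A y <= qform B y) ->
  qform (invmx B) x <= qform (invmx A) x.
Proof.
move=> Ap Bp AB.
have quad (M : 'M[R]_n) : posdef M ->
    qform M (x *m invmx M) = dotv x (x *m invmx M) /\
    qform (invmx M) x = dotv x (x *m invmx M).
  move=> Mp; rewrite dotvE /qform mulmxKV ?posdef_unitmx//; split=> //.
  by rewrite trmx_mul trmx_inv Mp.1 mulmxA.
have [qA ->] := quad A Ap; have [qB ->] := quad B Bp.
have := posdef_qform_ge0 (x *m invmx A - x *m invmx B) Ap.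
rewrite qformB ?Ap.1// mulmxKV ?posdef_unitmx// qA.
have := AB (x *m invmx B); rewrite qB; lra.
Qed.

Lemma qform_delta (n : nat) (A : 'M[R]_n) (i : 'I_n) :
  qform A (delta_mx 0 i) = A i i.
Proof. by rewrite /qform trmx_delta -rowE -colE !mxE. Qed.

Lemma dotv_delta (n : nat) (i : 'I_n) (x : 'rV[R]_n) :
  dotv (delta_mx 0 i) x = x 0 i.
Proof.
rewrite /dotv (bigD1 i)//= big1 ?addr0 => [|j ji]; rewrite !mxE eqxx/=.
  by rewrite eqxx mul1r.
by rewrite (negbTE ji) mul0r.
Qed.

Lemma mxtrace_le (n : nat) (c : R) (A : 'M[R]_n) :
  (forall x, qform A x <= c * dotv x x) -> \tr A <= n%:R * c.
Proof.
move=> Ac; rewrite -[n in leRHS]card_ord mulr_natl -sumr_const; apply: ler_sum => i _.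
by have := Ac (delta_mx 0 i); rewrite qform_delta dotv_delta mxE !eqxx mulr1.
Qed.

(** The concavity inequality based at [c I]; its linear term [c^-1 \tr A - n] is nonpositive. *)
Lemma ln_det_le (n : nat) (c : R) (A : 'M[R]_n) : posdef A -> 0 < c ->
  (forall x, qform A x <= c * dotv x x) -> ln (\det A) <= n%:R * ln c.
Proof.
move=> Ap c0 /mxtrace_le trA; have := ln_det_sub_le Ap (posdef_scalar n c0).
rewrite det_scalar lnXn// invmx_scalar mul_scalar_mx linearZ /= => h.
rewrite mulr_natl -subr_le0; apply: le_trans h _.
by rewrite pmulr_rle0 ?invr_gt0// linearB /= subr_le0 mxtrace_scalar -mulr_natl.
Qed.

(** The concavity inequality based at [A] this time; its linear term involves [\tr (A^-1)], which
    inversion being order reversing bounds by [n / c]. *)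
Lemma ln_det_ge (n : nat) (c : R) (A : 'M[R]_n) : posdef A -> 0 < c ->
  (forall x, c * dotv x x <= qform A x) -> n%:R * ln c <= ln (\det A).
Proof.
move=> Ap c0 Ac; have := ln_det_sub_le (posdef_scalar n c0) Ap.
rewrite det_scalar lnXn// => h; rewrite mulr_natl -subr_le0; apply: le_trans h _.
rewrite mulmxBr mulVmx ?posdef_unitmx// linearB /= mul_mx_scalar subr_le0.
rewrite linearZ /= mxtrace1 mulrC -ler_pdivlMr//; apply: mxtrace_le => x.
rewrite -qform_scalar -invmx_scalar.
by apply: qform_inv_anti => // [|y]; [exact: posdef_scalar|rewrite qform_scalar].
Qed.

Lemma dotvC (n : nat) (x y : 'rV[R]_n) : dotv x y = dotv y x.
Proof. by apply: eq_bigr => i _; rewrite mulrC. Qed.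

(** Cauchy-Schwarz for [y] in the ball, from the nonnegative square of [x - <x, y> y]. *)
Lemma dotv_sqr_le (n : nat) (x y : 'rV[R]_n) : in_ball y -> dotv x y ^+ 2 <= dotv x x.
Proof.
rewrite /in_ball => y1.
have dotB c : dotv (x - c *: y) (x - c *: y) =
    dotv x x - 2 * c * dotv x y + c ^+ 2 * dotv y y.
  rewrite /dotv !mulr_sumr -sumrB -big_split/=.
  by apply: eq_bigr => i _; rewrite !mxE; ring.
have := dotv_ge0 (x - dotv x y *: y); rewrite dotB.
have := ler_wpM2l (sqr_ge0 (dotv x y)) y1; lra.
Qed.

End PosDef.

(** * The log-determinant potential along a path *)

Section Measurability.
Variable R : realType.
Notation mu := (@lebesgue_measure R).
Implicit Types D : set R.

Lemma measurable_det D (n : nat) (M : R -> 'M[R]_n) :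
  (forall i j, measurable_fun D (fun t => M t i j)) ->
  measurable_fun D (fun t => \det (M t)).
Proof.
move=> mM; rewrite /determinant; apply: measurable_sum => s.
apply: measurable_funM; first exact: measurable_cst.
by apply: measurable_prod => i _.
Qed.

Lemma measurable_invr D (f : R -> R) : measurable D ->
  (forall t, D t -> f t != 0) -> measurable_fun D f ->
  measurable_fun D (fun t => (f t)^-1).
Proof.
move=> mD f0 mf.
have oE : open [set x : R | x != 0] by exact: open_neq.
apply: (@measurable_comp _ _ _ _ _ _ [set x : R | x != 0]) => //.
- exact: open_measurable.
- by move=> _ [t Dt <-] /=; exact: f0.
- apply: open_continuous_measurable_fun => // x; rewrite inE => x0.
  exact: inv_continuous.
Qed.

(** Cramer's rule: entries of the inverse are cofactors over the determinant, and determinants are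
    polynomial in the entries. *)
Lemma measurable_invmx D (n : nat) (M : R -> 'M[R]_n) : measurable D ->
  (forall t, D t -> M t \in unitmx) ->
  (forall i j, measurable_fun D (fun t => M t i j)) ->
  forall i j, measurable_fun D (fun t => invmx (M t) i j).
Proof.
move=> mD Mu mM i j.
apply: (eq_measurable_fun (fun t => (\det (M t))^-1 * cofactor (M t) j i)).
  by move=> t /set_mem Dt; rewrite /invmx Mu// !mxE.
apply: measurable_funM.
  apply: measurable_invr => // [t Dt|]; last exact: measurable_det.
  by rewrite -unitfE -unitmxE Mu.
apply: measurable_funM; first exact: measurable_cst.
apply: measurable_det => k l.
by apply: eq_measurable_fun (mM (lift j k) (lift i l)) => t _; rewrite !mxE.
Qed.

Lemma bounded_integrable (T M : R) (f : R -> R) D :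
  measurable D -> D `<=` `[0, T] -> measurable_fun `[0, T] f ->
  (forall t, `[0, T]%classic t -> `|f t| <= M) -> mu.-integrable D (EFin \o f).
Proof.
move=> mD DT mf fM.
suff fT : mu.-integrable `[0, T] (EFin \o f).
  by apply: integrableS fT => //; exact: measurable_itv.
apply: measurable_bounded_integrable => //.
  by rewrite /= lebesgue_measure_itv /=; case: ifP => //; rewrite ltry.
exists M; split; first exact: num_real.
by move=> x Mx t /fM /le_trans; apply; exact: ltW.
Qed.

Lemma Rintegral_sum D (I : Type) (s : seq I) (f : I -> R -> R) :
  measurable D -> (forall i, mu.-integrable D (EFin \o f i)) ->
  Rintegral mu D (fun t => \sum_(i <- s) f i t) =
  \sum_(i <- s) Rintegral mu D (f i).
Proof.
move=> mD fi; elim: s => [|i s IH].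
  rewrite big_nil; under eq_Rintegral do rewrite big_nil.
  by rewrite Rintegral_cst// mul0r.
rewrite big_cons -IH; under eq_Rintegral do rewrite big_cons.
rewrite RintegralD//.
have := @integrable_sum _ _ _ mu D mD _ s xpredT _ (fun i _ => fi i).
by apply: eq_integrable => // t _; rewrite /= sumEFin.
Qed.

End Measurability.

(** * The matrix [Wmat] along a fixed path, and the integrated gain *)

Section Path.
Variables (R : realType) (d : nat) (p : 'rV[R]_d -> R) (lam T K : R).
Variable a : R -> 'rV[R]_d.
Hypothesis lam0 : 0 < lam.
Hypothesis aT : admissible_path T a.
Hypothesis mp : measurable_fun `[0, T] (p \o a).
Hypothesis pK : forall t, `[0, T]%classic t -> 0 <= p (a t) <= K.

Notation mu := (@lebesgue_measure R).
Notation W := (Wmat p lam a).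

Lemma path_coord_le1 t i : `[0, T]%classic t -> `|a t 0 i| <= 1.
Proof.
move=> /aT.2 at1; have := dotv_sqr_le (delta_mx 0 i) at1.
by rewrite !dotv_delta mxE !eqxx -real_normK ?num_real// expr_le1.
Qed.

Let moment i j t := p (a t) * a t 0 i * a t 0 j.

Let measurable_moment i j : measurable_fun `[0, T] (moment i j).
Proof.
apply: measurable_funM; last exact: aT.1.
by apply: measurable_funM => //; exact: aT.1.
Qed.

Let moment_bound i j t : `[0, T]%classic t -> `|moment i j t| <= K.
Proof.
move=> tT; have /andP[p0 pk] := pK tT.
rewrite /moment !normrM -[K]mulr1 -[K]mulr1 !ler_pM ?mulr_ge0 ?path_coord_le1//.
by rewrite ger0_norm.
Qed.

Let sub_itv0T s t : 0 <= s -> t <= T -> `]s, t] `<=` `[0, T].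
Proof.
move=> s0 tT x /=; rewrite !in_itv/= => /andP[sx xt].
by rewrite (le_trans s0 (ltW sx)) (le_trans xt tT).
Qed.

Let moment_integrable D i j : measurable D -> D `<=` `[0, T] ->
  mu.-integrable D (EFin \o moment i j).
Proof.
move=> mD DT; apply: (bounded_integrable mD DT (@measurable_moment i j)).
by move=> t; exact: moment_bound.
Qed.

(** With [V] the inverse of [W] at an end of the interval this is the linear term of the concavity
    inequality; with [V = x^T x] it gives the increment of [qform (W _) x]. *)
Lemma Wmat_incr s t (V : 'M[R]_d) : 0 <= s -> s <= t -> t <= T ->
  \tr (V *m (W t - W s)) =
  Rintegral mu `]s, t] (fun r => p (a r) * qform V (a r)).
Proof.
move=> s0 st tT; have DT := sub_itv0T s0 tT.
transitivity (Rintegral mu `]s, t] (fun r => \sum_i \sum_j V i j * moment j i r)).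
  have iV i j : mu.-integrable `]s, t] (EFin \o (fun r => V i j * moment j i r)).
    have := @integrableZl _ _ _ mu _ (measurable_itv _) (V i j) _
      (moment_integrable j i (measurable_itv _) DT).
    by apply: eq_integrable.
  rewrite Rintegral_sum//; last first.
    move=> i; have := @integrable_sum _ _ _ mu _ (measurable_itv _) _
      (index_enum 'I_d) xpredT _ (fun j _ => iV i j).
    by apply: eq_integrable => // r _; rewrite /= sumEFin.
  apply: eq_bigr => i _; rewrite Rintegral_sum// mxE; apply: eq_bigr => j _.
  rewrite RintegralZl//; last exact: moment_integrable.
  congr (_ * _); rewrite !mxE opprD addrACA subrr add0r.
  apply: Rintegral_itvB; rewrite ?bnd_simp//.
  apply: moment_integrable => // r /=; rewrite !in_itv/= => /andP[-> rt].
  exact: le_trans rt tT.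
apply: eq_Rintegral => r _; rewrite qformE mulr_sumr; apply: eq_bigr => i _.
by rewrite mulr_sumr; apply: eq_bigr => j _; rewrite /moment; ring.
Qed.

Lemma Wmat0 : W 0 = lam%:M.
Proof.
apply/matrixP => i j; rewrite !mxE set_itv1 Rintegral_set1 addr0.
by rewrite mulr_natr.
Qed.

Lemma Wmat_sym t : (W t)^T = W t.
Proof.
apply/matrixP => i j; rewrite !mxE eq_sym; congr (_ + _).
by apply: eq_Rintegral => s _; ring.
Qed.

Lemma measurable_qform (V : R -> 'M[R]_d) :
  (forall i j, measurable_fun `[0, T] (fun t => V t i j)) ->
  measurable_fun `[0, T] (fun t => qform (V t) (a t)).
Proof.
move=> mV; apply: (eq_measurable_fun
  (fun t => \sum_(i < d) \sum_(j < d) V t i j * (a t 0 i * a t 0 j))).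
  by move=> t _; rewrite qformE.
apply: measurable_sum => i; apply: measurable_sum => j.
by apply: measurable_funM => //; apply: measurable_funM; exact: aT.1.
Qed.

Lemma qform_Wmat_sub s t x : 0 <= s -> s <= t -> t <= T ->
  qform (W t) x - qform (W s) x =
  Rintegral mu `]s, t] (fun r => p (a r) * dotv x (a r) ^+ 2).
Proof.
move=> s0 st tT.
have -> : qform (W t) x - qform (W s) x = \tr ((x^T *m x) *m (W t - W s)).
  by rewrite !qform_tr mulmxBr linearB /= ![\tr (_ *m (_ *m _))]mxtrace_mulC.
rewrite Wmat_incr//; apply: eq_Rintegral => r _; congr (_ * _).
by rewrite /qform mulmxA -mulmxA mxE big_ord1 -!dotvE dotvC -expr2.
Qed.

Let weighted_sqr_integrable x D : measurable D -> D `<=` `[0, T] ->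
  mu.-integrable D (EFin \o (fun r => p (a r) * dotv x (a r) ^+ 2)).
Proof.
move=> mD DT; apply: (bounded_integrable (M := K * dotv x x) mD DT).
  apply: measurable_funM => //; apply: measurable_funX.
  by apply: measurable_sum => i; apply: measurable_funM => //; exact: aT.1.
move=> r rT; have /andP[p0 pk] := pK rT.
rewrite ger0_norm; last by rewrite mulr_ge0 ?sqr_ge0.
by rewrite ler_pM ?sqr_ge0// dotv_sqr_le//; exact: aT.2.
Qed.

Lemma qform_Wmat_incr s t x : 0 <= s -> s <= t -> t <= T ->
  0 <= qform (W t) x - qform (W s) x <= K * (t - s) * dotv x x.
Proof.
move=> s0 st tT; have DT := sub_itv0T s0 tT; rewrite qform_Wmat_sub//.
have pq r : `[0, T]%classic r -> 0 <= p (a r) * dotv x (a r) ^+ 2 <= K * dotv x x.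
  move=> rT; have /andP[p0 pk] := pK rT; rewrite mulr_ge0 ?sqr_ge0//=.
  by rewrite ler_pM ?sqr_ge0// dotv_sqr_le//; exact: aT.2.
apply/andP; split; first by apply: Rintegral_ge0 => r /DT/pq/andP[].
rewrite mulrAC.
have -> : K * dotv x x * (t - s) = Rintegral mu `]s, t] (fun=> K * dotv x x).
  rewrite Rintegral_cst; last exact: measurable_itv.
  rewrite /= lebesgue_measure_itv/= lte_fin.
  by case: ltP => // ts; rewrite (le_anti (introT andP (conj st ts))) subrr.
apply: le_Rintegral => // [|| r /DT/pq/andP[]//].
  exact: weighted_sqr_integrable.
by apply: (bounded_integrable (M := `|K * dotv x x|) _ DT).
Qed.

Let K_ge0 t : 0 <= t -> t <= T -> 0 <= K.
Proof.
move=> t0 tT; have /andP[] : 0 <= p (a t) <= K by apply: pK; rewrite /= in_itv/= t0.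
exact: le_trans.
Qed.

Lemma Wmat_ge t x : 0 <= t -> t <= T -> lam * dotv x x <= qform (W t) x.
Proof.
move=> t0 tT; have /andP[+ _] := qform_Wmat_incr x (lexx 0) t0 tT.
by rewrite Wmat0 qform_scalar subr_ge0.
Qed.

Lemma posdef_Wmat t : 0 <= t -> t <= T -> posdef (W t).
Proof.
move=> t0 tT; split=> [|x x0]; first exact: Wmat_sym.
by apply: lt_le_trans (Wmat_ge x t0 tT); rewrite mulr_gt0// dotv_gt0.
Qed.

Let rate_ge0 s t : 0 <= s -> s <= t -> t <= T -> 0 <= K * (t - s) / lam.
Proof.
move=> s0 st tT; apply: divr_ge0; last exact: ltW.
by rewrite mulr_ge0 ?subr_ge0// (K_ge0 s0 (le_trans st tT)).
Qed.

(** The additive increment [K (t - s) |x|^2] becomes a multiplicative one because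
    [|x|^2 <= qform (W s) x / lam]. *)
Lemma Wmat_growth s t x : 0 <= s -> s <= t -> t <= T ->
  qform (W t) x <= (1 + K * (t - s) / lam) * qform (W s) x.
Proof.
move=> s0 st tT; have /andP[_] := qform_Wmat_incr x s0 st tT.
have := Wmat_ge x s0 (le_trans st tT); set q := qform (W s) x => h1 h2.
have := ler_wpM2l (rate_ge0 s0 st tT) h1; rewrite mulrA divfK ?gt_eqF//; lra.
Qed.

Lemma invWmat_anti s t x : 0 <= s -> s <= t -> t <= T ->
  qform (invmx (W t)) x <= qform (invmx (W s)) x.
Proof.
move=> s0 st tT; apply: qform_inv_anti => [||y].
- by apply: posdef_Wmat => //; exact: le_trans tT.
- by apply: posdef_Wmat => //; exact: le_trans st.
- by have /andP[] := qform_Wmat_incr y s0 st tT; rewrite subr_ge0.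
Qed.

Lemma invWmat_growth s t x : 0 <= s -> s <= t -> t <= T ->
  qform (invmx (W s)) x <= (1 + K * (t - s) / lam) * qform (invmx (W t)) x.
Proof.
move=> s0 st tT; set c := 1 + _.
have Ws : posdef (W s) by apply: posdef_Wmat => //; exact: le_trans tT.
have Wt : posdef (W t) by apply: posdef_Wmat => //; exact: le_trans st.
have c0 : 0 < c by rewrite ltr_pwDl// rate_ge0.
have := qform_inv_anti x Wt (posdef_scale c0 Ws).
rewrite invmxZ ?unitmxZ ?unitfE ?gt_eqF ?posdef_unitmx// qformZ => h.
rewrite -ler_pdivrMl//; apply: h => y.
by rewrite qformZ; exact: Wmat_growth.
Qed.

Lemma integrandE t : integrand p lam a t = qform (invmx (W t)) (a t).
Proof. by rewrite qform_tr. Qed.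

Lemma integrand_bound t : `[0, T]%classic t ->
  0 <= integrand p lam a t <= lam^-1.
Proof.
move=> tT; have /andP[t0 t1] : 0 <= t <= T by move: tT; rewrite /= in_itv.
rewrite integrandE posdef_qform_ge0/=; last exact/posdef_inv/posdef_Wmat.
apply: le_trans (invWmat_anti _ (lexx 0) t0 t1) _.
rewrite Wmat0 invmx_scalar qform_scalar -[leRHS]mulr1 ler_pM2l ?invr_gt0//.
exact: aT.2.
Qed.

(** Each entry is an indefinite integral of a bounded function, hence continuous. *)
Lemma measurable_Wmat i j : measurable_fun `[0, T] (fun t => W t i j).
Proof.
have [T0|T0] := leP 0 T; last first.
  by rewrite set_itv_ge ?bnd_simp -?ltNge//; exact: measurable_fun_set0.
apply: (eq_measurable_fun (fun t =>
  lam * (i == j)%:R + parameterized_integral mu 0 t (moment i j))).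
  by move=> t _; rewrite mxE.
apply: measurable_funD; first exact: measurable_cst.
apply: subspace_continuous_measurable_fun; first exact: measurable_itv.
apply: parameterized_integral_continuous => //.
by apply: moment_integrable => //; exact: measurable_itv.
Qed.

Lemma measurable_integrand : measurable_fun `[0, T] (integrand p lam a).
Proof.
apply: (eq_measurable_fun (fun t => qform (invmx (W t)) (a t))).
  by move=> t _; rewrite integrandE.
apply: measurable_qform; apply: measurable_invmx => //; last exact: measurable_Wmat.
by move=> t /=; rewrite in_itv/= => /andP[t0 tT]; exact/posdef_unitmx/posdef_Wmat.
Qed.

Let gain_bound t : `[0, T]%classic t ->
  `|p (a t) * integrand p lam a t| <= K / lam.
Proof.
move=> tT; have /andP[p0 pk] := pK tT; have /andP[i0 iK] := integrand_bound tT.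
by rewrite ger0_norm ?mulr_ge0// ler_pM.
Qed.

Let gain_integrable D : measurable D -> D `<=` `[0, T] ->
  mu.-integrable D (EFin \o (fun t => p (a t) * integrand p lam a t)).
Proof.
move=> mD DT; apply: (bounded_integrable mD DT _ gain_bound).
by apply: measurable_funM => //; exact: measurable_integrand.
Qed.

(* Comparing [W r] with the two ends of the interval replaces the chain rule
   for [ln (\det (W t))] by concavity, up to a factor that tends to 1. *)
Let gain_step s t : 0 <= s -> s <= t -> t <= T ->
  let c := 1 + K * (t - s) / lam in
  let I := Rintegral mu `]s, t] (fun r => p (a r) * integrand p lam a r) in
  let D := ln (\det (W t)) - ln (\det (W s)) in
  I <= c * D /\ D <= c * I.
Proof.
move=> s0 st tT c I D; have DT := sub_itv0T s0 tT.
have sT := le_trans st tT; have t0 := le_trans s0 st.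
have Ws := posdef_Wmat s0 sT; have Wt := posdef_Wmat t0 tT.
have c0 : 0 <= c by rewrite addr_ge0// rate_ge0.
have intV (V : 'M[R]_d) : posdef V -> (forall x, qform V x <= lam^-1 * dotv x x) ->
    mu.-integrable `]s, t] (EFin \o (fun r => p (a r) * qform V (a r))).
  move=> Vp VK; apply: (bounded_integrable (M := K / lam) _ DT) => //.
    by apply: measurable_funM => //; apply: measurable_qform.
  move=> r rT; have /andP[p0 pk] := pK rT.
  rewrite ger0_norm ?mulr_ge0 ?posdef_qform_ge0//.
  rewrite ler_pM ?posdef_qform_ge0//; apply: le_trans (VK _) _.
  by rewrite -[leRHS]mulr1 ler_pM2l ?invr_gt0//; exact: aT.2.
have invK u x : 0 <= u -> u <= T -> qform (invmx (W u)) x <= lam^-1 * dotv x x.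
  move=> u0 uT; apply: le_trans (invWmat_anti x (lexx 0) u0 uT) _.
  by rewrite Wmat0 invmx_scalar qform_scalar.
have intI := gain_integrable (measurable_itv `]s, t]) DT.
have ends r : `]s, t]%classic r -> [/\ 0 <= r, s <= r, r <= t, r <= T & 0 <= p (a r)].
  move=> rst; have /DT rT := rst; have /andP[-> _] := pK rT.
  by move: rst rT; rewrite /= !in_itv/= => /andP[/ltW -> ->] /andP[-> ->].
(* For [r] in between, the inverse of [W r] is below that of [W s], hence below [c] times that of
   [W t]; concavity based at [W t] then bounds the trace by [D]. *)
have upper : I <= c * \tr (invmx (W t) *m (W t - W s)).
  rewrite Wmat_incr// -RintegralZl//; last first.
    by apply: intV => [|x]; [exact: posdef_inv|exact: invK].
  apply: le_Rintegral => //.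
    have iZ := @integrableZl _ _ _ mu _ (measurable_itv `]s, t]) c _
      (intV _ (posdef_inv Wt) (fun x => invK t x t0 tT)).
    by apply: eq_integrable iZ.
  move=> r /ends[r0 sr rt rT p0]; rewrite integrandE mulrCA ler_wpM2l//.
  apply: le_trans (invWmat_anti _ s0 sr rT) _; exact: invWmat_growth.
(* Conversely the inverse of [W s] is below [c] times that of [W t], hence below [c] times that of
   [W r]; concavity based at [W s] bounds [D] by this trace. *)
have lower : \tr (invmx (W s) *m (W t - W s)) <= c * I.
  rewrite Wmat_incr// -RintegralZl//.
  apply: le_Rintegral => //.
  - by apply: intV => [|x]; [exact: posdef_inv|exact: invK].
  - have iZ := @integrableZl _ _ _ mu _ (measurable_itv `]s, t]) c _ intI.
    by apply: eq_integrable iZ.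
  move=> r /ends[r0 sr rt rT p0]; rewrite integrandE mulrCA ler_wpM2l//.
  apply: le_trans (invWmat_growth _ s0 st tT) _.
  by rewrite ler_wpM2l//; exact: invWmat_anti.
split; last exact: le_trans (ln_det_sub_le Wt Ws) lower.
apply: le_trans upper _; rewrite ler_wpM2l//.
have := ln_det_sub_le Ws Wt; rewrite -[W s - W t]opprB mulmxN linearN /D /=; lra.
Qed.

(** All pieces have length [T / n], so [gain_step] applies with one constant [c] and its
    inequalities simply add up. *)
Let gain_partition (n m : nat) : (0 < n)%N -> (m <= n)%N -> 0 <= T ->
  let c := 1 + K * (T / n%:R) / lam in
  let t := m%:R * (T / n%:R) in
  let I := Rintegral mu `[0, t] (fun r => p (a r) * integrand p lam a r) in
  let D := ln (\det (W t)) - ln (\det (W 0)) in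
  I <= c * D /\ D <= c * I.
Proof.
move=> n0 mn T0; elim: m mn => [|m IH] mn /=.
  by rewrite mul0r set_itv1 Rintegral_set1 subrr mulr0.
have h0 : 0 <= T / n%:R by rewrite divr_ge0.
have [] := IH (ltnW mn); set c := 1 + _; set t := m%:R * _ => I1 I2.
have -> : m.+1%:R * (T / n%:R) = t + T / n%:R by rewrite -natr1 mulrDl mul1r.
have t0 : 0 <= t by rewrite mulr_ge0.
have tT : t + T / n%:R <= T.
  rewrite /t -[X in _ + X]mul1r -mulrDl natr1 mulrA mulrAC ler_piMl//.
  by rewrite ler_pdivrMr ?ltr0n// mul1r ler_nat.
have [] := gain_step t0 _ tT; first by rewrite lerDl.
rewrite [t + _ - t]addrC addKr -/c => J1 J2.
have -> : Rintegral mu `[0, t + T / n%:R] (fun r => p (a r) * integrand p lam a r) =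
    Rintegral mu `[0, t] (fun r => p (a r) * integrand p lam a r) +
    Rintegral mu `]t, t + T / n%:R] (fun r => p (a r) * integrand p lam a r).
  apply/eqP; rewrite [eqbRHS]addrC -subr_eq; apply/eqP.
  apply: Rintegral_itvB; rewrite ?bnd_simp ?lerDl//.
  apply: gain_integrable => // r /=; rewrite !in_itv/= => /andP[-> rt].
  exact: le_trans rt tT.
lra.
Qed.

(* Integrated form of [(ln (\det (W t)))' = p (a t) * integrand p lam a t]. *)
Lemma log_det_potential : 0 <= T ->
  Rintegral mu `[0, T] (fun r => p (a r) * integrand p lam a r) =
  ln (\det (W T)) - d%:R * ln lam.
Proof.
move=> T0; set I := Rintegral _ _ _; set D := (RHS).
have le_limit (x y : R) : (forall n, (0 < n)%N -> x <= (1 + K * (T / n%:R) / lam) * y) ->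
    x <= y.
  move=> xy; rewrite leNgt; apply/negP => yx.
  (* For [n] beyond this bound the error term [(K T / lam) y / n] is smaller than the gap [x - y].
     The absolute value is there because [y] has no assumed sign. *)
  pose B := `|K * T / lam * y / (x - y)|.
  have B0 : 0 <= B by exact: normr_ge0.
  have := archi_boundP B0; set n := Num.bound B => Bn.
  have n0 : 0 < n%:R :> R by exact: le_lt_trans Bn.
  have := xy n; rewrite -(ltr0n R) => /(_ n0).
  have {}Bn : K * T / lam * y / (x - y) < n%:R by exact: le_lt_trans (ler_norm _) Bn.
  move: Bn; rewrite ltr_pdivrMr ?subr_gt0// => Bn.
  have -> : (1 + K * (T / n%:R) / lam) * y = y + (K * T / lam * y) / n%:R.
    by field; rewrite !gt_eqF.
  by rewrite -lerBlDl leNgt ltr_pdivrMr// [_ * n%:R]mulrC Bn.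
have ID n : (0 < n)%N -> I <= (1 + K * (T / n%:R) / lam) * D /\
    D <= (1 + K * (T / n%:R) / lam) * I.
  move=> n0; have := gain_partition n0 (leqnn n) T0.
  rewrite [n%:R * (T / _)]mulrC divfK ?pnatr_eq0 -?lt0n// Wmat0 det_scalar.
  by rewrite lnXn// -[_ *+ d]mulr_natl.
by apply/le_anti/andP; split; apply: le_limit => n /ID[].
Qed.

Let integralE : (\int[mu]_(t in cc0 T) (integrand p lam a t)%:E)%E =
  (Rintegral mu `[0, T] (integrand p lam a))%:E.
Proof.
rewrite /Rintegral fineK//; apply: integrable_fin_num; first exact: measurable_itv.
apply: (bounded_integrable (M := lam^-1)) measurable_integrand _ => //.
by move=> t /integrand_bound/andP[i0 iK]; rewrite ger0_norm.
Qed.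

Let integrand_integrable : mu.-integrable `[0, T] (EFin \o integrand p lam a).
Proof.
apply: (bounded_integrable (M := lam^-1)) measurable_integrand _ => //.
by move=> t /integrand_bound/andP[i0 iK]; rewrite ger0_norm.
Qed.

(** Since the integrand is nonnegative, [q * integrand] lies below the gain, whose integral is known
    exactly. *)
Lemma integral_integrand_le q : 0 <= T -> 0 < q ->
  (forall t, `[0, T]%classic t -> q <= p (a t)) ->
  (\int[mu]_(t in cc0 T) (integrand p lam a t)%:E <=
   ((ln (\det (W T)) - d%:R * ln lam) / q)%:E)%E.
Proof.
move=> T0 q0 qp; rewrite integralE lee_fin ler_pdivlMr// -log_det_potential//.
rewrite mulrC -RintegralZl//.
apply: le_Rintegral => //.
- have iZ := @integrableZl _ _ _ mu _ (measurable_itv `[0, T]) q _ integrand_integrable.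
  by apply: eq_integrable iZ => //; exact: measurable_itv.
- by apply: gain_integrable => //; exact: measurable_itv.
by move=> t tT; rewrite ler_wpM2r ?qp//; have /andP[] := integrand_bound tT.
Qed.

Lemma integral_integrand_ge q : 0 <= T -> 0 < q ->
  (forall t, `[0, T]%classic t -> p (a t) <= q) ->
  (((ln (\det (W T)) - d%:R * ln lam) / q)%:E <=
   \int[mu]_(t in cc0 T) (integrand p lam a t)%:E)%E.
Proof.
move=> T0 q0 qp; rewrite integralE lee_fin ler_pdivrMr// -log_det_potential//.
rewrite mulrC -RintegralZl//.
apply: le_Rintegral => //.
- by apply: gain_integrable => //; exact: measurable_itv.
- have iZ := @integrableZl _ _ _ mu _ (measurable_itv `[0, T]) q _ integrand_integrable.
  by apply: eq_integrable iZ => //; exact: measurable_itv.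
by move=> t tT; rewrite ler_wpM2r ?qp//; have /andP[] := integrand_bound tT.
Qed.

Lemma ln_det_Wmat_le : 0 <= T -> ln (\det (W T)) <= d%:R * ln (lam + K * T).
Proof.
move=> T0; apply: ln_det_le => [||x]; first exact: posdef_Wmat.
  by rewrite ltr_pwDl// mulr_ge0// (@K_ge0 0).
have /andP[_] := qform_Wmat_incr x (lexx 0) T0 (lexx T).
by rewrite Wmat0 qform_scalar subr0 mulrDl lerBlDl.
Qed.

Lemma qform_Wmat_cst s t b x : 0 <= s -> s <= t -> t <= T ->
  (forall r, s <= r < t -> a r = b) ->
  qform (W t) x = qform (W s) x + p b * dotv x b ^+ 2 * (t - s).
Proof.
move=> s0 st tT ab; have DT := sub_itv0T s0 tT.
apply/eqP; rewrite addrC -subr_eq; apply/eqP; rewrite qform_Wmat_sub//.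
(* The endpoint [t] is dropped as a null set: a step path may already have switched action there. *)
rewrite -Rintegral_itv_bndo_bndc; last first.
  apply: weighted_sqr_integrable => // r rst; apply: DT.
  by move: rst; rewrite /= !in_itv/= => /andP[-> /ltW].
transitivity (Rintegral mu `]s, t[ (fun=> p b * dotv x b ^+ 2)).
  apply: eq_Rintegral => r; rewrite inE/= in_itv/= => /andP[sr rt].
  by rewrite ab// (ltW sr).
rewrite Rintegral_cst; last exact: measurable_itv.
rewrite /= lebesgue_measure_itv/= lte_fin.
by case: ltP => // ts; rewrite (le_anti (introT andP (conj st ts))) subrr.
Qed.

End Path.

(** * Bounds on the value *)

Section Censorship.
Variables (R : realType) (d k : nat) (phi : nat -> R) (u : 'rV[R]_d) (pr : nat -> R).
Hypothesis model : is_censorship_model k phi u pr.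
Notation p := (censor_prob k phi u pr).

Lemma phi_le i j : (i <= j)%N -> (j <= k.+1)%N -> phi i <= phi j.
Proof.
have [[_ _ phiS _] _] := model.
elim: j => [|j IH]; first by rewrite leqn0 => /eqP->.
rewrite leq_eqVlt ltnS => /predU1P[->//|ij] jk.
by apply: le_trans (IH ij (ltnW jk)) (ltW (phiS _ _)).
Qed.

Lemma phi_itv j : (j <= k.+1)%N -> phi j \in `[- (pi / 2), pi / 2].
Proof.
have [[phi0 phik _ _] _] := model.
by move=> jk; rewrite in_itv/= -{1}phi0 -phik !phi_le.
Qed.

Lemma sin_phi_le i j : (i <= j)%N -> (j <= k.+1)%N -> sin (phi i) <= sin (phi j).
Proof.
move=> ij jk; rewrite leNgt ltr_sin ?phi_itv ?(leq_trans ij)//.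
by rewrite -leNgt phi_le.
Qed.

(** This gap below 1 is the room in which [u] can be tilted without leaving the last region. *)
Lemma sin_phi_last_lt1 : sin (phi k) < 1.
Proof.
have [[_ phik phiS _] _] := model.
by rewrite -(sin_pihalf R) -phik ltr_sin ?phi_itv// phiS.
Qed.

Lemma pr_le i j : (i <= j)%N -> (j <= k)%N -> pr j <= pr i.
Proof.
have [_ [_ prS _]] := model.
elim: j => [|j IH]; first by rewrite leqn0 => /eqP->.
rewrite leq_eqVlt ltnS => /predU1P[->//|ij] jk.
by apply: le_trans (prS _ jk) (IH ij (ltnW jk)).
Qed.

Lemma pr_gt0 j : (j <= k)%N -> 0 < pr j.
Proof.
by have [_ [_ _ pk]] := model => jk; apply: lt_le_trans pk (pr_le jk (leqnn k)).
Qed.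

Lemma dotv_axis_le1 x : in_ball x -> `|dotv x u| <= 1.
Proof.
have [[_ _ _ u1] _] := model => x1.
have := dotv_sqr_le u x1; rewrite u1 dotvC -real_normK ?num_real//.
by rewrite expr_le1.
Qed.

Lemma censor_prob_term_ge0 x (j : 'I_k.+1) :
  0 <= (if (sin (phi j) <= dotv x u) && (dotv x u < sin (phi j.+1))
        then pr j else 0).
Proof. by case: ifP => // _; rewrite ltW// pr_gt0// -ltnS. Qed.

(** All summands are nonnegative, so one active summand of size at least [pr k] is enough. *)
Lemma censor_prob_ge x : in_ball x -> pr k <= p x.
Proof.
have [[phi0 phik _ _] _] := model => /dotv_axis_le1; rewrite ler_norml => /andP[xl xu].
rewrite /censor_prob; case: eqP => x1.
  by rewrite lerDr sumr_ge0// => j _; exact: censor_prob_term_ge0.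
rewrite addr0.
have ex : exists j, dotv x u < sin (phi j.+1).
  by exists k; rewrite phik sin_pihalf lt_neqAle xu andbT; apply/eqP.
(* The first threshold above [<x, u>] closes the region of [x]: minimality gives the lower end,
   which for [j = 0] is [-1]. *)
case: (ex_minnP ex) => j xj jmin.
have jk : (j < k.+1)%N.
  by rewrite ltnS jmin// phik sin_pihalf lt_neqAle xu andbT; apply/eqP.
rewrite (bigD1 (Ordinal jk))//= xj andbT.
have -> : sin (phi j) <= dotv x u.
  case: j xj jmin {jk} => [|j] xj jmin; first by rewrite phi0 sinN sin_pihalf.
  by rewrite leNgt; apply/negP => /jmin; rewrite ltnn.
rewrite -[leLHS]addr0 lerD ?pr_le// sumr_ge0// => i _.
exact: censor_prob_term_ge0.
Qed.

(** Counts the [k + 2] summands of the definition, each at most 1; the constant ends up inside a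
    logarithm. *)
Lemma censor_prob_le x : p x <= k.+2%:R.
Proof.
have pr1 j : (j <= k)%N -> pr j <= 1.
  by have [_ [p1 _ _]] := model => jk; apply: le_trans p1; exact: pr_le.
rewrite /censor_prob -natr1 lerD//; last by case: ifP => // _; exact: pr1.
rewrite -[k.+1 in leRHS]card_ord -sumr_const; apply: ler_sum => j _.
by case: ifP => // _; rewrite pr1// -ltnS.
Qed.

Lemma censor_prob_last x : in_ball x -> sin (phi k) <= dotv x u -> p x = pr k.
Proof.
have [[phi0 phik _ _] _] := model => /dotv_axis_le1; rewrite ler_norml => /andP[_ xu] kx.
rewrite /censor_prob (bigD1 ord_max)//= big1 => [|j jk]; last first.
  case: ifP => // /andP[_]; rewrite ltNge (le_trans _ kx)// sin_phi_le//.
  by rewrite ltn_neqAle -ltnS ltn_ord andbT; move: jk; rewrite -val_eqE.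
rewrite kx phik sin_pihalf addr0 /=.
(* The term of region [k] and the term for [<x, u> = 1] are complementary: exactly one equals
   [pr k]. *)
by case: ltgtP xu => //; rewrite (addr0, add0r).
Qed.

Lemma measurable_censor_prob T (a : R -> 'rV[R]_d) :
  admissible_path T a -> measurable_fun `[0, T] (p \o a).
Proof.
move=> [ma _].
have mdot : measurable_fun `[0, T] (fun t => dotv (a t) u).
  by apply: measurable_sum => i; apply: measurable_funM.
apply: measurable_funD.
  apply: measurable_sum => j; apply: measurable_fun_if => //.
  by apply: measurable_and; [exact: measurable_fun_ler|exact: measurable_fun_ltr].
by apply: measurable_fun_if => //; exact: measurable_fun_eqr.
Qed.

End Censorship.

(** * Upper bound for all paths, and a piecewise constant path for the lower bound *)

Section Steering.
Variables (R : realType) (d k : nat) (phi : nat -> R) (u : 'rV[R]_d) (pr : nat -> R).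
Hypothesis model : is_censorship_model k phi u pr.
Variable (lam : R).
Hypothesis lam0 : 0 < lam.
Notation p := (censor_prob k phi u pr).

Lemma value_le T : 0 <= T ->
  (value p lam T <= ((d%:R * ln (lam + k.+2%:R * T) - d%:R * ln lam) / pr k)%:E)%E.
Proof.
move=> T0; apply: ub_ereal_sup => _ [a aT <-].
have pK t : `[0, T]%classic t -> 0 <= p (a t) <= k.+2%:R.
  move=> tT; rewrite censor_prob_le// andbT.
  by apply: le_trans (censor_prob_ge model (aT.2 _ tT)); rewrite ltW// (pr_gt0 model).
have mp : measurable_fun `[0, T] (p \o a) by exact: measurable_censor_prob.
have pk0 := pr_gt0 model (leqnn k).
apply: le_trans (integral_integrand_le lam0 aT mp pK T0 pk0 _) _.
  by move=> t tT; apply: censor_prob_ge => //; exact: aT.2.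
rewrite lee_fin ler_pM2r ?invr_gt0// lerB//.
exact: ln_det_Wmat_le pK _.
Qed.

Definition step_path (h : R) (b : nat -> 'rV[R]_d) (t : R) : 'rV[R]_d :=
  b (Num.truncn (t / h)).

Lemma step_pathE h b m t : 0 < h -> m%:R * h <= t < m.+1%:R * h ->
  step_path h b t = b m.
Proof.
move=> h0 /andP[mt tm]; congr (b _); apply: truncn_def.
by rewrite ler_pdivlMr// ltr_pdivrMr// mt.
Qed.

Lemma step_path_admissible h b T : 0 < h -> (forall m, in_ball (b m)) ->
  admissible_path T (step_path h b).
Proof.
move=> h0 b1; split=> [i|t _]; last exact: b1.
(* On [[0, T]] only indices below [N] occur, so each coordinate is a finite sum of indicators of
   intervals. *)
pose N := (Num.truncn (T / h)).+1.
apply: (eq_measurable_fun (fun t : R => \sum_(m < N)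
    (if (m%:R <= t / h) && (t / h < m.+1%:R) then b m 0 i else 0) : R)).
  move=> t; rewrite inE/= in_itv/= => /andP[t0 tT].
  have th0 : 0 <= t / h by rewrite divr_ge0// ltW.
  have tN : (Num.truncn (t / h) < N)%N.
    by rewrite ltnS le_truncn// ler_pM2r// invr_gt0.
  rewrite (bigD1 (Ordinal tN))//= truncn_itv// big1 ?addr0// => m mt.
  rewrite -truncn_eq// ifF//; apply: contraNF mt => /eqP tm.
  by rewrite -val_eqE/= tm.
have mth : measurable_fun `[0, T] (fun t => t / h) by exact: measurable_funM.
apply: measurable_sum => m; apply: measurable_fun_if => //.
by apply: measurable_and; [exact: measurable_fun_ler|exact: measurable_fun_ltr].
Qed.

(** The horizon [n h] stays fixed while [m] runs, so the path hypotheses are established once; every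
    piece adds [pr k * h] times a squared projection. *)
Lemma step_path_qform n h b x : 0 < h -> (forall m, in_ball (b m)) ->
  (forall m, p (b m) = pr k) ->
  forall m, (m <= n)%N ->
  qform (Wmat p lam (step_path h b) (m%:R * h)) x =
  lam * dotv x x + pr k * h * \sum_(l < m) dotv x (b l) ^+ 2.
Proof.
move=> h0 b1 bk; set T := n%:R * h.
have aT := step_path_admissible T h0 b1.
have mp : measurable_fun `[0, T] (p \o step_path h b) by exact: measurable_censor_prob.
have pK t : `[0, T]%classic t -> 0 <= p (step_path h b t) <= k.+2%:R.
  by move=> _; rewrite censor_prob_le// andbT bk ltW// (pr_gt0 model).
elim=> [|m IH] mn.
  by rewrite mul0r Wmat0 qform_scalar big_ord0 mulr0 addr0.
have mh : 0 <= m%:R * h by rewrite mulr_ge0// ltW.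
have mh1 : m%:R * h <= m.+1%:R * h by rewrite ler_pM2r// ler_nat.
have mT : m.+1%:R * h <= T by rewrite ler_pM2r// ler_nat.
rewrite (qform_Wmat_cst lam aT mp pK x mh mh1 mT (b := b m)); last first.
  by move=> r; exact: step_pathE.
rewrite IH ?(ltnW mn)// big_ord_recr/= bk -mulrBl -natrB// subSnn; ring.
Qed.

(** The triangle inequality [|u + eps v| <= 1 + eps], in squared form. *)
Lemma tilt_in_ball eps (v : 'rV[R]_d) : 0 <= eps -> in_ball v ->
  in_ball ((1 + eps)^-1 *: (u + eps *: v)).
Proof.
have [[_ _ _ u1] _] := model => e0 v1; rewrite /in_ball.
have := dotv_axis_le1 model v1; rewrite ler_norml => /andP[_ vu].
have dE r : dotv (r *: (u + eps *: v)) (r *: (u + eps *: v)) =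
    r ^+ 2 * (dotv u u + 2 * eps * dotv v u + eps ^+ 2 * dotv v v).
  rewrite /dotv !mulr_sumr -!big_split mulr_sumr /=.
  by apply: eq_bigr => i _; rewrite !mxE; ring.
rewrite dE u1 exprVn.
have e1 : 0 < (1 + eps) ^+ 2 by rewrite exprn_gt0// ltr_pwDl.
rewrite ler_pdivrMl// mulr1.
have := ler_wpM2l (sqr_ge0 eps) v1; have := ler_wpM2l e0 vu; lra.
Qed.

Lemma tilt_axis eps (v : 'rV[R]_d) : 0 <= eps -> in_ball v ->
  (1 - eps) / (1 + eps) <= dotv ((1 + eps)^-1 *: (u + eps *: v)) u.
Proof.
have [[_ _ _ u1] _] := model => e0 v1.
have := dotv_axis_le1 model v1; rewrite ler_norml => /andP[vu _].
have dE r : dotv (r *: (u + eps *: v)) u = (dotv u u + eps * dotv v u) * r.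
  rewrite mulrC /dotv !mulr_sumr -!big_split mulr_sumr /=.
  by apply: eq_bigr => i _; rewrite !mxE; ring.
rewrite dE u1 ler_pM2r ?invr_gt0 ?ltr_pwDl//.
have := ler_wpM2l e0 vu; lra.
Qed.

(** Indexed by [nat] because [step_path] takes a sequence. From [d] on it is the zero row, still in
    the ball; this covers time [T], where the step index is [d + d]. *)
Definition basis_row (m : nat) : 'rV[R]_d := \row_j (j == m :> nat)%:R.

Lemma dotv_basis_row (i : 'I_d) x : dotv x (basis_row i) = x 0 i.
Proof.
rewrite -dotv_delta dotvC; congr (dotv _ _).
by apply/rowP => j; rewrite !mxE eqxx.
Qed.

Lemma basis_row_in_ball m : in_ball (basis_row m).
Proof.
have [md|md] := ltnP m d.
  by rewrite /in_ball (dotv_basis_row (Ordinal md)) mxE eqxx.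
rewrite /in_ball /dotv big1// => j _; rewrite !mxE ltn_eqF ?mul0r//.
exact: leq_trans (ltn_ord j) md.
Qed.

(* The actions [u + eps e_i] and [u - eps e_i], rescaled to the ball, stay in
   the last region, and their differences span the whole space. *)
Definition tilt (eps : R) (m : nat) : 'rV[R]_d :=
  (1 + eps)^-1 *: (u + eps *:
    (if (m < d)%N then basis_row m else - basis_row (m - d))).

(** Pairing both signs cancels the cross terms between [<x, u>] and [x 0 i], and the remaining
    [2 <x, u>^2] is dropped. *)
Lemma sum_tilt_ge eps x :
  2 * (eps / (1 + eps)) ^+ 2 * dotv x x <=
  \sum_(m < d + d) dotv x (tilt eps m) ^+ 2.
Proof.
rewrite big_split_ord /= -big_split mulr_sumr; apply: ler_sum => i _ /=.
rewrite /tilt ltn_ord ltnNge leq_addr/= addKn.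
have tE (v : 'rV[R]_d) : dotv x ((1 + eps)^-1 *: (u + eps *: v)) =
    (dotv x u + eps * dotv x v) / (1 + eps).
  rewrite mulrC /dotv mulr_sumr -big_split mulr_sumr /=.
  by apply: eq_bigr => j _; rewrite !mxE; ring.
have xN : dotv x (- basis_row i) = - x 0 i.
  rewrite -dotv_basis_row /dotv -sumrN.
  by apply: eq_bigr => j _; rewrite !mxE mulrN.
rewrite !tE xN dotv_basis_row !expr_div_n -mulrDl.
have -> : 2 * (eps ^+ 2 / (1 + eps) ^+ 2) * (x 0 i * x 0 i) =
    2 * (eps * x 0 i) ^+ 2 / (1 + eps) ^+ 2 by ring.
rewrite ler_wpM2r ?invr_ge0 ?sqr_ge0//.
have := sqr_ge0 (dotv x u); lra.
Qed.

Lemma value_ge : (0 < d)%N -> exists2 c, 0 < c & forall T, 0 < T ->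
  (((d%:R * ln (c * T) - d%:R * ln lam) / pr k)%:E <= value p lam T)%E.
Proof.
(* Small enough that [(1 - eps) / (1 + eps) >= sin (phi k)], the condition under which every tilt
   stays in the last region. *)
move=> d0; pose eps := (1 - sin (phi k)) / 4.
have sk1 := sin_phi_last_lt1 model; have skN := sin_geN1 (phi k).
have e0 : 0 < eps by rewrite divr_gt0// subr_gt0.
have pk0 := pr_gt0 model (leqnn k).
have v1 m : in_ball (if (m < d)%N then basis_row m else - basis_row (m - d)).
  case: ifP => _; first exact: basis_row_in_ball.
  rewrite /in_ball (_ : dotv _ _ = dotv (basis_row (m - d)) (basis_row (m - d))).
    exact: basis_row_in_ball.
  by apply: eq_bigr => j _; rewrite !mxE mulrNN.
have b1 m : in_ball (tilt eps m) by apply: tilt_in_ball => //; exact: ltW.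
have bk m : p (tilt eps m) = pr k.
  apply: censor_prob_last => //; apply: le_trans (tilt_axis (ltW e0) (v1 m)).
  by rewrite ler_pdivlMr ?ltr_pwDl ?ltW// /eps; nra.
(* Each of the [2 d] tilts is played for time [T / (2 d)]; the factor 2 of [sum_tilt_ge] leaves [d]
   in the denominator. *)
pose c := pr k * (eps / (1 + eps)) ^+ 2 / d%:R.
have dR0 : 0 < d%:R :> R by rewrite ltr0n.
have c0 : 0 < c.
  by rewrite divr_gt0// mulr_gt0// exprn_gt0// divr_gt0// ltr_pwDl// ltW.
exists c => // T T0; set h := T / (d + d)%:R.
have h0 : 0 < h by rewrite divr_gt0// ltr0n addn_gt0 d0.
have hT : (d + d)%:R * h = T by rewrite mulrC divfK// pnatr_eq0 -lt0n addn_gt0 d0.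
set a := step_path h (tilt eps).
have aT : admissible_path T a by exact: step_path_admissible.
have mp : measurable_fun `[0, T] (p \o a) by exact: measurable_censor_prob.
have pK t : `[0, T]%classic t -> 0 <= p (a t) <= k.+2%:R.
  by move=> _; rewrite censor_prob_le// andbT bk ltW.
have apk t : `[0, T]%classic t -> p (a t) <= pr k by rewrite bk.
have T0' := ltW T0.
apply: le_trans (ereal_sup_ubound _); last by exists a.
apply: le_trans (integral_integrand_ge lam0 aT mp pK T0' pk0 apk).
rewrite lee_fin ler_pM2r ?invr_gt0// lerB//; apply: ln_det_ge.
- exact: (posdef_Wmat lam0 aT mp pK).
- exact: mulr_gt0.
move=> x; rewrite -[in leRHS]hT (step_path_qform (n := d + d))//.
rewrite -[leLHS]add0r lerD//; first by rewrite mulr_ge0 ?dotv_ge0// ltW.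
apply: le_trans (ler_wpM2l _ (sum_tilt_ge eps x)); last by rewrite mulr_ge0 ?ltW.
rewrite /c /h natrD le_eqVlt; apply/orP; left; apply/eqP; field.
by rewrite !gt_eqF// ltr_pwDl// ltW.
Qed.

End Steering.

(** * Logarithmic asymptotics of the value *)

Theorem theorem3 (R : realType) (d k : nat) (phi : nat -> R) (u : 'rV[R]_d)
    (pr : nat -> R) (lam : R) :
  (2 <= d)%N ->
  is_censorship_model k phi u pr ->
  0 < lam ->
  exists deff : R, 0 < deff /\
    (forall eps : R, 0 < eps ->
       \forall T \near +oo,
         (((deff - eps) * ln T)%:E <= value (censor_prob k phi u pr) lam T)%E /\
         (value (censor_prob k phi u pr) lam T <= ((deff + eps) * ln T)%:E)%E) /\
    ((exists j : nat, (j <= k)%N /\ deff = d%:R / pr j) \/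
     (exists i j : nat, [/\ (i < j)%N /\ (j <= k)%N,
        Num.max 1 (sstar d phi i j) < pr i / pr j,
        pr i / pr j < rstar d phi i j,
        deff = (pr j)^-1 *
           ((d%:R - 1) * (1 - lfun phi i j) / (pr i / pr j - lfun phi i j)
            + (ufun phi i j - 1) / (ufun phi i j - pr i / pr j)) &
        deff < d%:R / pr j])).
Proof.
move=> d2 model lam0; have d0 := ltnW d2.
have pk0 := pr_gt0 model (leqnn k).
exists (d%:R / pr k); split; first by rewrite divr_gt0// ltr0n.
split; last by left; exists k.
move=> eps eps0; have [c c0 lower] := value_ge model lam0 d0.
pose K : R := k.+2%:R.
(* Once [ln T] exceeds [C1] and [C2], the bounded terms of the lower and upper bounds are at most
   [eps * ln T]. *)
pose C1 := d%:R / pr k * (ln lam - ln c) / eps.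
pose C2 := d%:R / pr k * (ln (lam + K) - ln lam) / eps.
have K0 : 0 < K by rewrite ltr0n.
near=> T.
have T1 : 1 <= T by near: T; apply: nbhs_pinfty_ge; exact: num_real.
have T0 : 0 < T by exact: lt_le_trans T1.
have lnT C : expR C <= T -> C <= ln T.
  by move=> CT; rewrite -[C]expRK ler_ln ?posrE ?expR_gt0.
have TC1 : C1 <= ln T.
  by apply: lnT; near: T; apply: nbhs_pinfty_ge; exact: num_real.
have TC2 : C2 <= ln T.
  by apply: lnT; near: T; apply: nbhs_pinfty_ge; exact: num_real.
split.
  apply: le_trans (lower T T0); rewrite lee_fin lnM ?posrE//.
  move: TC1; rewrite /C1 ler_pdivrMr// => TC1.
  have -> : (d%:R * (ln c + ln T) - d%:R * ln lam) / pr k =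
      d%:R / pr k * ln T - d%:R / pr k * (ln lam - ln c).
    by field; rewrite gt_eqF.
  by rewrite mulrBl lerB// [leRHS]mulrC.
apply: le_trans (value_le model lam0 (ltW T0)) _; rewrite lee_fin -/K.
move: TC2; rewrite /C2 ler_pdivrMr// => TC2.
(* From [T >= 1]: [lam + K T <= (lam + K) T]. *)
have lnK : ln (lam + K * T) <= ln (lam + K) + ln T.
  have lamK : 0 < lam + K by exact: addr_gt0.
  have lamKT : 0 < lam + K * T by rewrite addr_gt0// mulr_gt0.
  rewrite -lnM ?posrE// ler_ln ?posrE// ?mulr_gt0//.
  by rewrite [leRHS]mulrDl lerD2r ler_peMr// ltW.
apply: (@le_trans _ _ ((d%:R * (ln (lam + K) + ln T) - d%:R * ln lam) / pr k)).
  by rewrite ler_pM2r ?invr_gt0// lerB// ler_wpM2l.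
have -> : (d%:R * (ln (lam + K) + ln T) - d%:R * ln lam) / pr k =
    d%:R / pr k * ln T + d%:R / pr k * (ln (lam + K) - ln lam).
  by field; rewrite gt_eqF.
by rewrite mulrDl lerD// [leRHS]mulrC.
Unshelve. all: by end_near.
Qed.
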